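(* Let $d\ge 1$, let $V\subset\mathcal P_d$ be a proper $*$-ideal, and let $\{Q_k\}_{k=0}^{\varkappa_V}$ be a rigid $V$-basis of $\mathcal P_d$ consisting of real column polynomials (all entries have real coefficients) with $Q_0=1$. Assume that $\{Q_k\}_{k=0}^{\varkappa_V}$ obeys the three term recurrence relation: for every $j=1,\ldots,d$ there exist scalar (complex) matrices $A_{k,j}$ (of size $d_V(k)\times d_V(k+1)$ for $0\le k<\varkappa_V$) and $B_{k,j}$ (of size $d_V(k)\times d_V(k)$) such that $$X_jQ_k \stackrel{V}{=} A_{k,j}Q_{k+1}+B_{k,j}Q_k+A_{k-1,j}^*Q_{k-1}\qquad\text{for all } k\in\mathbb N,\ k\le\varkappa_V,\ j=1,\ldots,d,$$ where $A_{-1,j}=1$ and $Q_{-1}=0$, and where, if $\varkappa_V<\infty$, $A_{\varkappa_V,j}$ is the column $[1,\ldots,1]^{\top}$ with $d_V(\varkappa_V)$ entries and $Q_{\varkappa_V+1}=0$ (a single zero polynomial). Then for all $n\in\mathbb N$, $n\le\varkappa_V$, and all $j=1,\ldots,d$, the polynomial $(x_j-y_j)K_n(x,y)$ in the $2d$ variables $(x,y)$ is equal to $$[A_{n,j}Q_{n+1}(x)]^{\top}Q_n(y)-Q_n(x)^{\top}[A_{n,j}Q_{n+1}(y)]$$ modulo the ideal $V_2=V\otimes\mathcal P_d+\mathcal P_d\otimes V\subset\mathcal P_{2d}$ (i.e. the difference of the two polynomials belongs to $V_2$).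
   Context: $\mathbb N=\{0,1,2,\ldots\}$. $\mathcal P_d$ is the space of all complex polynomials in $d$ real variables, $\mathcal P_d^k$ its subspace of polynomials of degree at most $k$, and $X_1,\ldots,X_d$ are the coordinate polynomials. For $p\in\mathcal P_d$, $\bar p$ is defined by $\bar p(x)=\overline{p(x)}$, $x\in\mathbb R^d$. An ideal $V\subset\mathcal P_d$ is a $*$-ideal if $p\in V$ implies $\bar p\in V$. Let $\Pi_V:\mathcal P_d\to\mathcal P_d/V$ be the canonical quotient map. Set $d_V(0)=1$ and $d_V(k)=\dim\Pi_V(\mathcal P_d^k)-\dim\Pi_V(\mathcal P_d^{k-1})$ for $k\ge1$. If $d_V(k)\ge1$ for all $k\ge0$, put $\varkappa_V=\infty$; otherwise $\varkappa_V=\max\{k\ge0: d_V(k)\ne0\}$ (once $d_V(k)=0$ for some $k\ge 1$, also $d_V(k+1)=0$). A column polynomial is a column vector with entries in $\mathcal P_d$. A sequence $\{Q_k\}_{k=0}^{\varkappa_V}$ (indexed by $k\in\mathbb N$, $k\le\varkappa_V$) is a rigid $V$-basis of $\mathcal P_d$ if each $Q_k=[q^{(k)}_1,\ldots,q^{(k)}_{d_V(k)}]^{\top}$ is a column polynomial of size $d_V(k)$ all of whose entries have degree $k$, and the family of cosets $q^{(k)}_{i}+V$ ($k\in\mathbb N$, $k\le\varkappa_V$, $i=1,\ldots,d_V(k)$) is a basis of $\mathcal P_d/V$. For column polynomials $P,Q$, $P\stackrel{V}{=}Q$ means that they have the same size and all entries of $P-Q$ lie in $V$. $X_jQ_k$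 is entrywise multiplication. $A^*$ is the conjugate transpose and $A^\top$ the transpose of a matrix; $Q^*=[\bar q_1,\ldots,\bar q_m]$ for $Q=[q_1,\ldots,q_m]^\top$. The Christoffel-Darboux kernel is $K_n(x,y)=\sum_{k=0}^nQ_k^*(y)Q_k(x)$, $x,y\in\mathbb R^d$. For linear subspaces $H_1,H_2\subset\mathcal P_d$, $H_1\otimes H_2$ is identified with the linear span in $\mathcal P_{2d}$ of the polynomials $(h_1\otimes h_2)(x,y)=h_1(x)h_2(y)$, $h_1\in H_1$, $h_2\in H_2$, $x,y\in\mathbb R^d$. *)

(* Defs.v *)
From HB Require Import structures.
From mathcomp Require Import all_boot all_order all_algebra.
From mathcomp Require Import ring_quotient sesquilinear spectral.
From mathcomp Require Import boolp classical_sets reals.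
From mathcomp Require Import complex mpoly.

Set Implicit Arguments.
Unset Strict Implicit.
Unset Printing Implicit Defensive.

Import Order.TTheory GRing.Theory Num.Theory.

Local Open Scope classical_set_scope.
Local Open Scope ring_scope.
Local Open Scope quotient_scope.
Local Open Scope sesquilinear_scope.

Section LinearAlgebra.
Variables (K : fieldType) (E : lmodType K).

Definition lspan (S : set E) : set E :=
  [set x | exists (m : nat) (c : 'I_m -> K) (v : 'I_m -> E),
     (forall i, S (v i)) /\ x = \sum_(i < m) c i *: v i].

Definition lin_indep (I : eqType) (b : I -> E) : Prop :=
  forall (s : seq I) (c : I -> K), uniq s ->
    \sum_(i <- s) c i *: b i = 0 -> {in s, forall i, c i = 0}.

Definition is_basis_of (I : eqType) (b : I -> E) (W : set E) : Prop :=
  [/\ forall i, W (b i), lin_indep b & W `<=` lspan (range b)].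

(* Only used for finite-dimensional W (the value is 0 otherwise). *)
Definition ldim (W : set E) : nat :=
  xget 0%N [set m | exists b : 'I_m -> E, is_basis_of b W].

End LinearAlgebra.

(* An idealr contains 0 but not 1, so it is a proper ideal.  The library makes
   {ideal_quot V} a ring; the K-vector space structure is added here. *)
Section QuotientSpace.
Variables (K : fieldType) (d : nat) (V : idealr {mpoly K[d]}).

Definition qscale (c : K) (x : {ideal_quot V}) : {ideal_quot V} :=
  \pi_{ideal_quot V} (c%:MP) * x.

Fact qscaleA a b x : qscale a (qscale b x) = qscale (a * b) x.
Proof. by rewrite /qscale mulrA mpolyCM rmorphM. Qed.

Fact qscale1 : left_id 1 qscale.
Proof. by move=> x; rewrite /qscale mpolyC1 rmorph1 mul1r. Qed.

Fact qscaleDr : right_distributive qscale +%R.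
Proof. by move=> c x y; rewrite /qscale mulrDr. Qed.

Fact qscaleDl x : {morph qscale^~ x : a b / a + b}.
Proof. by move=> a b; rewrite /qscale mpolyCD rmorphD mulrDl. Qed.

HB.instance Definition _ :=
  GRing.Zmodule_isLmodule.Build K {ideal_quot V}
    qscaleA qscale1 qscaleDr qscaleDl.

(* msize p is 1 + the degree of p, and msize 0 = 0. *)
Definition Pdeg (k : nat) : set {mpoly K[d]} := [set p | (msize p <= k.+1)%N].

Definition PiV : {mpoly K[d]} -> {ideal_quot V} := \pi_{ideal_quot V}.

Definition dV (k : nat) : nat :=
  if k is k'.+1 then (ldim (PiV @` Pdeg k) - ldim (PiV @` Pdeg k'))%N else 1%N.

(* None stands for infinity. *)
Definition kappa : option nat :=
  if `[< forall k, (1 <= dV k)%N >] then None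
  else Some (xget 0%N [set m | dV m <> 0%N /\
                               forall k, dV k <> 0%N -> (k <= m)%N]).

Definition le_kappa (k : nat) : bool := if kappa is Some m then (k <= m)%N else true.

(* A sequence of column polynomials is given for all k; only its terms with
   k <= kappa are ever meaningful. *)
Definition rigid_basis (Q : forall k, 'cV[{mpoly K[d]}]_(dV k)) : Prop :=
  (forall k (i : 'I_(dV k)), le_kappa k -> msize (Q k i 0) = k.+1) /\
  is_basis_of
    (fun t : {k : {k : nat | le_kappa k} & 'I_(dV (val k))} =>
       PiV (Q (val (tag t)) (tagged t) 0))
    [set: {ideal_quot V}].

Definition eqcolV (m : nat) (P Q : 'cV[{mpoly K[d]}]_m) : Prop :=
  forall i, (P i 0 - Q i 0) \in V.

Definition mxpoly_mul (m n : nat) (A : 'M[K]_(m, n)) (Q : 'cV[{mpoly K[d]}]_n) :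
  'cV[{mpoly K[d]}]_m := map_mx (@mpolyC d K) A *m Q.

(* A_k Q_(k+1) for k <= kappa.  At k = kappa < infinity the convention is that
   A_k is the column of ones and Q_(k+1) is a single zero polynomial. *)
Definition AQnext (k : nat) (Ak : 'M[K]_(dV k, dV k.+1))
    (Qk1 : 'cV[{mpoly K[d]}]_(dV k.+1)) : 'cV[{mpoly K[d]}]_(dV k) :=
  if le_kappa k.+1 then mxpoly_mul Ak Qk1
  else mxpoly_mul (const_mx 1) (0 : 'cV[{mpoly K[d]}]_1).

End QuotientSpace.

Section Complex.
Variables (C : numClosedFieldType) (d : nat).

Definition mpoly_bar (p : {mpoly C[d]}) : {mpoly C[d]} := map_mpoly Num.conj p.

(* bar p is the conjugate of p as a function on real points. *)
Lemma mpoly_barE (p : {mpoly C[d]}) (x : 'I_d -> C) :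
  (forall i, x i \is Num.real) -> (mpoly_bar p).@[x] = (p.@[x])^*.
Proof.
move=> x_real; rewrite /mpoly_bar /map_mpoly /mmap [p.@[x]]mevalE !raddf_sum /=.
apply: eq_bigr => m _; rewrite mevalM mevalC rmorphM /mmap1 !rmorph_prod.
by congr (_ * _); apply: eq_bigr => i _; rewrite !rmorphXn /= mevalXU conj_Creal.
Qed.

Definition star_ideal (V : idealr {mpoly C[d]}) : Prop :=
  forall p, p \in V -> mpoly_bar p \in V.

Definition col_adj (m : nat) (Q : 'cV[{mpoly C[d]}]_m) : 'rV[{mpoly C[d]}]_m :=
  map_mx mpoly_bar Q^T.

Definition real_col (m : nat) (Q : 'cV[{mpoly C[d]}]_m) : Prop :=
  forall i, Q i 0 \is a mpolyOver d Num.real.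

Variable V : idealr {mpoly C[d]}.

(* A_(k-1)^* Q_(k-1), with A_(-1) = 1 and Q_(-1) = 0. *)
Definition AQprev (A : forall k, 'M[C]_(dV V k, dV V k.+1))
    (Q : forall k, 'cV[{mpoly C[d]}]_(dV V k)) (k : nat) :
  'cV[{mpoly C[d]}]_(dV V k) :=
  match k with
  | 0 => mxpoly_mul 1%:M 0
  | k'.+1 => mxpoly_mul ((A k')^t*) (Q k')
  end.

Definition three_term (Q : forall k, 'cV[{mpoly C[d]}]_(dV V k))
    (A : forall k, 'I_d -> 'M[C]_(dV V k, dV V k.+1))
    (B : forall k, 'I_d -> 'M[C]_(dV V k)) : Prop :=
  forall (k : nat) (j : 'I_d), le_kappa V k ->
    eqcolV V ('X_j *: Q k)
      (AQnext (A k j) (Q k.+1) + mxpoly_mul (B k j) (Q k)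
       + AQprev (fun k => A k j) Q k).

Definition Xx (j : 'I_d) : {mpoly C[d + d]} := 'X_(lshift d j).
Definition Xy (j : 'I_d) : {mpoly C[d + d]} := 'X_(rshift d j).

Definition in_x (p : {mpoly C[d]}) : {mpoly C[d + d]} := p \mPo [tuple Xx i | i < d].
Definition in_y (p : {mpoly C[d]}) : {mpoly C[d + d]} := p \mPo [tuple Xy i | i < d].

Definition tensor (H1 H2 : set {mpoly C[d]}) : set {mpoly C[d + d]} :=
  lspan [set in_x h.1 * in_y h.2 | h in H1 `*` H2].

Definition V2 : set {mpoly C[d + d]} :=
  [set p + q | p in tensor [set` V] setT & q in tensor setT [set` V]].

Definition CDkernel (Q : forall k, 'cV[{mpoly C[d]}]_(dV V k)) (n : nat) :
  {mpoly C[d + d]} :=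
  \sum_(k < n.+1) (map_mx in_y (col_adj (Q k)) *m map_mx in_x (Q k)) 0 0.

Definition CDrhs (Q : forall k, 'cV[{mpoly C[d]}]_(dV V k))
    (A : forall k, 'I_d -> 'M[C]_(dV V k, dV V k.+1)) (n : nat) (j : 'I_d) :
  {mpoly C[d + d]} :=
  ((map_mx in_x (AQnext (A n j) (Q n.+1)))^T *m map_mx in_y (Q n)
   - (map_mx in_x (Q n))^T *m map_mx in_y (AQnext (A n j) (Q n.+1))) 0 0.

End Complex.

(* Main.v *)
From HB Require Import structures.
Require Import Defs.
From mathcomp Require Import all_boot all_order all_algebra.
From mathcomp Require Import ring_quotient classical_sets reals complex mpoly.
From mathcomp Require Import boolp sesquilinear spectral.

Local Open Scope ring_scope.

(** Write each relation as
      X_j Q_k = A_k Q_(k+1) + B_k Q_k + A_(k-1)^* Q_(k-1)   (mod V).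
    Multiplying (x_j - y_j) into the term Q_k(y)^T Q_k(x) of the kernel and using
    this relation in x and in y, the result telescopes modulo V_2 as soon as
    - A_(k-1)^* is the transpose of A_(k-1), i.e. A_(k-1) is real, so that the
      A^*-part of the k-th term cancels the A-part of the (k-1)-st one;
    - B_k is symmetric, so that the B-part of the k-th term vanishes.
    Neither property is assumed: both have to be extracted from the recurrence.

    Realness ([A_real]).  Conjugation preserves V and fixes the Q_k, so it
    commutes with taking coordinates modulo V on the basis (Q_k); the polynomial
    X_j Q_k being real, its coordinates on Q_(k+1), which are the entries of A_k,
    are real.

    Symmetry ([B_sym]).  This is the algebraic part of Favard's theorem.  Let L be
    the linear functional taking the coordinate on Q_0 = 1.  Then
      L(p q_i) = coordinate of p on q_i   for q_i in Q_l and deg p <= l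
    ([reproduced_degree]), that is, the Q_k are orthonormal for L.  It is enough
    to treat monomials p, by induction on the degree: in p = X_j p' the factor
    X_j is moved onto q_i, where the recurrence applies, while on the side of the
    coordinates the recurrence expresses those of X_j p' through those of p'
    ([cv_mulX]).  The coordinates of p on Q_l vanish for l > deg p, by the same
    induction ([cv_monomial_gt]); no dimension count is involved.  Finally
    B_k(i', i) = L(q_i X_j q_i') for q_i, q_i' in Q_k, which is symmetric. *)

(** * Coordinates on a basis *)

Section Coordinates.
Local Set Implicit Arguments.
Local Unset Strict Implicit.
Import GRing.Theory.

Variables (K : fieldType) (E : lmodType K) (I : eqType) (b : I -> E).
Hypothesis hb : is_basis_of b [set: E].

Lemma basis_combination (x : E) :
  exists s : seq (K * I), x = \sum_(u <- s) u.1 *: b u.2.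
Proof.
case: hb => _ _ /(_ x Logic.I) [m [c [v [hv ->]]]].
have /choice[f fE] : forall i, exists t, b t = v i.
  by move=> i; have [t _ <-] := hv i; exists t.
exists [seq (c i, f i) | i <- index_enum 'I_m].
by rewrite big_map; apply: eq_bigr => i _; rewrite /= fE.
Qed.

(** A formal combination may repeat basis vectors: in a vanishing one, the total
    coefficient of each vector is zero. *)
Lemma combination_eq0 (s : seq (K * I)) (t : I) :
  \sum_(u <- s) u.1 *: b u.2 = 0 -> \sum_(u <- s | u.2 == t) u.1 = 0.
Proof.
move=> s0; case: hb => _ /(_ (undup [seq u.2 | u <- s])) free _.
have /= h := free (fun t => \sum_(u <- s | u.2 == t) u.1) (undup_uniq _).
have [ts|tNs] := boolP (t \in [seq u.2 | u <- s]); last first.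
  rewrite big_seq_cond big1 // => u /andP[us /eqP ut].
  by case/negP: tNs; rewrite -ut map_f.
apply: h; last by rewrite mem_undup.
rewrite -[RHS]s0 [RHS]big_seq.
under eq_bigr do rewrite scaler_suml.
rewrite (exchange_big_dep xpredT) //= [LHS]big_seq.
apply: eq_bigr => u us.
rewrite (eq_bigl (pred1 u.2)); last by move=> i; rewrite /= eq_sym.
rewrite -big_filter filter_pred1_uniq ?undup_uniq ?mem_undup ?map_f //.
by rewrite big_seq1.
Qed.

Lemma exists_coordinate (t : I) : exists f : E -> K,
  [/\ forall x y, f (x + y) = f x + f y,
      forall a x, f (a *: x) = a * f x
    & forall s, f (b s) = (s == t)%:R].
Proof.
have [g gE] := choice basis_combination.
pose f x := \sum_(u <- g x | u.2 == t) u.1.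
(* f does not depend on the chosen combination. *)
have fE x s : x = \sum_(u <- s) u.1 *: b u.2 ->
    f x = \sum_(u <- s | u.2 == t) u.1.
  move=> xE; apply/eqP; rewrite -subr_eq0 /f; apply/eqP.
  have := @combination_eq0 (g x ++ [seq (- u.1, u.2) | u <- s]) t.
  rewrite !big_cat !big_map /= sumrN => -> //.
  under [X in _ + X]eq_bigr do rewrite scaleNr.
  by rewrite sumrN -gE -xE subrr.
exists f; split=> [x y|a x|s].
- rewrite (fE _ (g x ++ g y)) ?big_cat //=.
  by rewrite -!gE.
- rewrite (fE _ [seq (a * u.1, u.2) | u <- g x]) big_map /= ?mulr_sumr //.
  under eq_bigr do rewrite -scalerA.
  by rewrite -scaler_sumr -gE.
- rewrite (fE _ [:: (1, s)]); last by rewrite big_seq1 scale1r.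
  by rewrite big_cons big_nil /=; case: eqP => //; rewrite addr0.
Qed.

End Coordinates.

(** * Polynomials *)

Section Polynomials.
Local Set Implicit Arguments.
Local Unset Strict Implicit.
Import GRing.Theory Num.Theory.

Variables (C : numClosedFieldType) (d : nat).

Lemma mnm_split (m : 'X_{1.. d}) n : mdeg m = n.+1 ->
  exists j m', mdeg m' = n /\ 'X_[m] = 'X_j * 'X_[m'] :> {mpoly C[d]}.
Proof.
move=> mn; have : m != 0%MM by rewrite -mdeg_eq0 mn.
case/boolP: [exists j, m j != 0%N] => [/existsP[j mj] _|/existsPn m0].
  have jm : (U_(j) <= m)%MM by rewrite lep1mP.
  exists j, (m - U_(j))%MM; split; last by rewrite mulrC -mpolyXD submK.
  by apply/eqP; rewrite -eqSS -mn -{2}(submK jm) mdegD mdeg1 addn1.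
case/eqP; apply/mnmP => j; rewrite mnm0E; apply/eqP.
by have := m0 j; rewrite negbK.
Qed.

Lemma mpoly_bar_real (p : {mpoly C[d]}) :
  p \is a mpolyOver d Num.real -> mpoly_bar p = p.
Proof.
move=> /mpolyOverP pr; apply/mpolyP=> m.
by rewrite /mpoly_bar mcoeff_map_mpoly; apply: conj_Creal.
Qed.

Lemma mxpoly_mulE m n (M : 'M[C]_(m, n)) (q : 'cV[{mpoly C[d]}]_n) i :
  mxpoly_mul M q i 0 = \sum_i' M i i' *: q i' 0.
Proof.
rewrite /mxpoly_mul !mxE; apply: eq_bigr => i' _.
by rewrite mxE mul_mpolyC.
Qed.

Lemma mxpoly_mul0 m n (M : 'M[C]_(m, n)) :
  mxpoly_mul M (0 : 'cV[{mpoly C[d]}]_n) = 0.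
Proof. by rewrite /mxpoly_mul mulmx0. Qed.

End Polynomials.

(** * Coordinates modulo the ideal *)

Section RigidBasis.
Local Set Implicit Arguments.
Local Unset Strict Implicit.
Import GRing.Theory Num.Theory.

Variables (C : numClosedFieldType) (d : nat) (V : idealr {mpoly C[d]}).
Variable Q : forall k, 'cV[{mpoly C[d]}]_(dV V k).
Hypothesis hQ : rigid_basis Q.

Lemma scale_PiV (c : C) (p : {mpoly C[d]}) : c *: PiV V p = PiV V (c *: p).
Proof. by rewrite -mul_mpolyC /PiV rmorphM. Qed.

Lemma PiV_eq0 (p : {mpoly C[d]}) : PiV V p = 0 -> p \in V.
Proof.
by move=> p0; rewrite -[p]subr0 Quotient.idealrBE; apply/eqP; rewrite rmorph0.
Qed.

Lemma PiV_ideal (p : {mpoly C[d]}) : p \in V -> PiV V p = 0.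
Proof.
by rewrite -{1}[p]subr0 Quotient.idealrBE => /eqP; rewrite rmorph0.
Qed.

Lemma le_kappa_leq m n : (m <= n)%N -> le_kappa V n -> le_kappa V m.
Proof. by rewrite /le_kappa; case: kappa => // a; apply: leq_trans. Qed.

Lemma kappa_ge0 : le_kappa V 0.
Proof. by rewrite /le_kappa; case: kappa. Qed.

(** Modulo V every polynomial is a combination of entries of the Q_k, so a linear
    identity can be checked on V and on these entries. *)
Lemma rigid_basis_ind (P : {mpoly C[d]} -> Prop) :
    (forall c p q, P p -> P q -> P (c *: p + q)) ->
    (forall p, p \in V -> P p) ->
    (forall k i, le_kappa V k -> P (Q k i 0)) ->
  forall p, P p.
Proof.
move=> Plin PV PQ p.
have [s ps] := basis_combination hQ.2 (PiV V p).
pose q := \sum_(u <- s) u.1 *: Q (val (tag u.2)) (tagged u.2) 0.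
have Pr : P (p - q).
  apply/PV/PiV_eq0; rewrite /PiV rmorphB /= -/(PiV V p) ps rmorph_sum /=.
  rewrite -sumrB big1 // => u _.
  by rewrite [X in X - _]scale_PiV subrr.
have -> : p = q + (p - q) by rewrite addrC subrK.
move: Pr; rewrite /q {q ps}; move: (p - _).
elim: s => [|u s IHs] r Pr; first by rewrite big_nil add0r.
rewrite big_cons -addrA; apply: Plin; last exact: IHs.
exact/PQ/valP.
Qed.

(** [cv p] is the row of the coordinates of p + V on the entries of Q_l.  For l
    beyond kappa, where Q_l is meaningless, it is required to vanish. *)
Definition coordinate_row (l : nat)
    (cv : {linear {mpoly C[d]} -> 'rV[C]_(dV V l)}) : Prop :=
  [/\ forall p, p \in V -> cv p = 0,
      forall i, le_kappa V l -> cv (Q l i 0) = delta_mx 0 i,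
      forall k i, le_kappa V k -> k != l -> cv (Q k i 0) = 0
    & ~~ le_kappa V l -> forall p, cv p = 0].

Lemma exists_coordinate_row (l : nat) : exists cv, coordinate_row (l := l) cv.
Proof.
have [ll|lN] := boolP (le_kappa V l); last first.
  by exists \0; split=> // i; rewrite (negPf lN).
have /choice[f hf] := exists_coordinate hQ.2.
pose t (i : 'I_(dV V l)) : {k : {k | le_kappa V k} & 'I_(dV V (val k))} :=
  Tagged (fun k : {k | le_kappa V k} => 'I_(dV V (val k)))
         (i : 'I_(dV V (val (Sub l ll : {k | le_kappa V k})))).
pose g (p : {mpoly C[d]}) : 'rV[C]_(dV V l) := \row_i f (t i) (PiV V p).
have g_lin : linear g.
  move=> c p q; apply/rowP=> i; rewrite !mxE.
  have [fD fZ _] := hf (t i).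
  by rewrite /PiV rmorphD /= -!/(PiV V _) -scale_PiV fD fZ.
pose cv : {linear {mpoly C[d]} -> 'rV[C]_(dV V l)} :=
  HB.pack g (GRing.isLinear.Build _ _ _ _ g g_lin).
exists cv; split; last by rewrite ll.
- move=> p pV; apply/rowP=> i; rewrite !mxE (PiV_ideal pV).
  by have [_ fZ _] := hf (t i); rewrite -(scale0r 0) fZ mul0r.
- move=> i _; apply/rowP=> i'; rewrite !mxE eqxx /=.
  have [_ _ fb] := hf (t i').
  by rewrite (fb (t i)) eq_Tagged /= eq_sym.
- move=> k i kk kl; apply/rowP=> i'; rewrite !mxE.
  have [_ _ fb] := hf (t i').
  have := fb (Tagged (fun k : {k | le_kappa V k} => 'I_(dV V (val k)))
         (i : 'I_(dV V (val (Sub k kk : {k | le_kappa V k}))))).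
  rewrite /= => ->; case: eqP => // /(congr1 (fun u => val (tag u))) /= e.
  by rewrite e eqxx in kl.
Qed.

End RigidBasis.

(** * Consequences of the recurrence relation *)

Section Recurrence.
Local Arguments dV : simpl never.
Local Set Implicit Arguments.
Local Unset Strict Implicit.
Import GRing.Theory Num.Theory.
Local Open Scope sesquilinear_scope.

Variables (C : numClosedFieldType) (d : nat) (V : idealr {mpoly C[d]}).
Variable Q : forall k, 'cV[{mpoly C[d]}]_(dV V k).
Hypothesis hQ : rigid_basis Q.
Hypothesis hQ0 : Q 0 = const_mx 1.
Variables (A : forall k, 'I_d -> 'M[C]_(dV V k, dV V k.+1))
  (B : forall k, 'I_d -> 'M[C]_(dV V k)).
Hypothesis hAB : three_term Q A B.

Variable cv : forall l, {linear {mpoly C[d]} -> 'rV[C]_(dV V l)}.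
Hypothesis hcv : forall l, coordinate_row Q (cv l).

Lemma cvV l p : p \in V -> cv l p = 0.
Proof. by have [+ _ _ _] := hcv l; apply. Qed.

Lemma cvQ l i : le_kappa V l -> cv l (Q l i 0) = delta_mx 0 i.
Proof. by have [_ + _ _] := hcv l; apply. Qed.

Lemma cvQ_neq l k i : le_kappa V k -> k != l -> cv l (Q k i 0) = 0.
Proof. by have [_ _ + _] := hcv l; apply. Qed.

Lemma cv_gt_kappa l p : ~~ le_kappa V l -> cv l p = 0.
Proof. by move=> lN; have [_ _ _ ->] := hcv l. Qed.

Lemma cv_mxpoly_mul k m (M : 'M[C]_(m, dV V k)) i :
  le_kappa V k -> cv k (mxpoly_mul M (Q k) i 0) = row i M.
Proof.
move=> kk; rewrite mxpoly_mulE linear_sum [RHS]row_sum_delta /=.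
by apply: eq_bigr => i' _; rewrite linearZ /= cvQ // mxE.
Qed.

Lemma cv_mxpoly_mul_neq l k m (M : 'M[C]_(m, dV V k)) i :
  le_kappa V k -> k != l -> cv l (mxpoly_mul M (Q k) i 0) = 0.
Proof.
move=> kk kl; rewrite mxpoly_mulE linear_sum /= big1 // => i' _.
by rewrite linearZ /= cvQ_neq // scaler0.
Qed.

Lemma three_termE j k i : le_kappa V k ->
  'X_j * Q k i 0 - (AQnext (A k j) (Q k.+1) i 0 + mxpoly_mul (B k j) (Q k) i 0
                    + AQprev (A^~ j) Q k i 0) \in V.
Proof.
move=> kk; have := hAB j kk i.
have addE (M N : 'cV[{mpoly C[d]}]_(dV V k)) : (M + N) i 0 = M i 0 + N i 0.
  by rewrite mxE.
by rewrite !addE mxE.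
Qed.

(** The contribution of the coordinates on Q_(l-1) to those of X_j p on Q_l. *)
Definition cv_prev (j : 'I_d) (l : nat) (p : {mpoly C[d]}) : 'rV[C]_(dV V l) :=
  match l with
  | 0 => 0
  | l'.+1 => cv l' p *m A l' j
  end.

(** Multiplication by X_j in coordinates: the recurrence, transposed. *)
Lemma cv_mulX j l p : le_kappa V l ->
  cv l ('X_j * p) =
    cv_prev j l p + cv l p *m B l j + cv l.+1 p *m (A l j)^t*.
Proof.
move=> ll; move: p; apply: (rigid_basis_ind hQ).
- move=> c p q hp hq.
  have -> : 'X_j * (c *: p + q) = c *: ('X_j * p) + 'X_j * q.
    by rewrite mulrDr scalerAr.
  rewrite !linearP /= hp hq !mulmxDl -!scalemxAl !scalerDr.
  have -> : cv_prev j l (c *: p + q) = c *: cv_prev j l p + cv_prev j l q.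
    case: (l) => [|l'] /=; first by rewrite scaler0 addr0.
    by rewrite linearP mulmxDl scalemxAl.
  by rewrite addrACA; congr (_ + _); rewrite addrACA.
- move=> p pV; rewrite !cvV ?idealMr // !mul0mx !addr0.
  by case: (l) => [|l'] //=; rewrite cvV // mul0mx.
move=> k i kk; have := three_termE j i kk.
move=> /(cvV l) /eqP; rewrite linearB subr_eq0 => /eqP ->.
rewrite !linearD /=; congr (_ + _ + _).
- rewrite /AQnext; case: (boolP (le_kappa V k.+1)) => [kk1|kN]; last first.
    rewrite mxpoly_mul0 mxE linear0; case: (l) ll => [|l'] //= ll'.
    by rewrite cvQ_neq ?mul0mx //; apply: contraNneq kN => ->.
  case: (l) => [|l'] /=; first by rewrite cv_mxpoly_mul_neq.
  case: (eqVneq k l') => [<-|kl].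
    by rewrite cv_mxpoly_mul // cvQ // rowE.
  by rewrite cv_mxpoly_mul_neq // cvQ_neq // mul0mx.
- case: (eqVneq k l) => [<-|kl].
    by rewrite cv_mxpoly_mul // cvQ // rowE.
  by rewrite cv_mxpoly_mul_neq // cvQ_neq // mul0mx.
case: k kk i => [|k] kk i /=.
  by rewrite mxpoly_mul0 mxE linear0 cvQ_neq // mul0mx.
have kk' := le_kappa_leq (leqnSn k) kk.
case: (eqVneq k l) => [<-|kl].
  by rewrite cv_mxpoly_mul // cvQ // rowE.
by rewrite cv_mxpoly_mul_neq // cvQ_neq // mul0mx.
Qed.

(* dV V 0 is 1 by definition. *)
Let i0 : 'I_(dV V 0) := ord0 : 'I_1.

Lemma Q0E i : Q 0 i 0 = 1.
Proof. by rewrite hQ0 mxE. Qed.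

Lemma cv_monomial_gt (m : 'X_{1.. d}) l : (mdeg m < l)%N -> cv l 'X_[m] = 0.
Proof.
have [n mn] := ubnP (mdeg m); elim: n m mn l => // n IHn m mn l ml.
have [ll|lN] := boolP (le_kappa V l); last exact: cv_gt_kappa.
case E: (mdeg m) ml => [|e] ml.
  move/eqP: E; rewrite mdeg_eq0 => /eqP->; rewrite mpolyX0 -(Q0E i0).
  by rewrite cvQ_neq ?kappa_ge0 // neq_ltn ml.
have [j [m' [m'e ->]]] := mnm_split C E.
have m'n : (mdeg m' < n)%N by rewrite m'e -ltnS -E.
have van k : (e < k)%N -> cv k 'X_[m'] = 0.
  by move=> ek; apply: IHn; rewrite // m'e.
rewrite cv_mulX //; case: l ml ll => // l el ll.
have el1 := leqW el; have el2 := leqW el1.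
by rewrite /cv_prev !van // !mul0mx !addr0.
Qed.

Hypothesis hV : star_ideal V.
Hypothesis hQreal : forall k, le_kappa V k -> real_col (Q k).

Lemma cv_bar l p : cv l (mpoly_bar p) = map_mx Num.conj (cv l p).
Proof.
move: p; apply: (rigid_basis_ind hQ).
- move=> c p q hp hq.
  rewrite /mpoly_bar rmorphD /= map_mpolyZ -!/(mpoly_bar _) !linearP hp hq /=.
  by rewrite map_mxD map_mxZ.
- by move=> p pV; rewrite !cvV ?map_mx0 // hV.
move=> k i kk; rewrite mpoly_bar_real; last exact: hQreal.
case: (eqVneq k l) => [<-|kl]; last by rewrite cvQ_neq // map_mx0.
by rewrite cvQ // map_delta_mx.
Qed.

(** Only k < kappa matters: the other [A k j] do not occur in the recurrence. *)
Lemma A_real k j : le_kappa V k.+1 -> map_mx Num.conj (A k j) = A k j.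
Proof.
move=> kk1; have kk := le_kappa_leq (leqnSn k) kk1.
apply/row_matrixP => i.
have rowA : cv k.+1 ('X_j * Q k i 0) = row i (A k j).
  rewrite cv_mulX // /cv_prev cvQ // !cvQ_neq ?neq_ltn ?ltnS ?leqnn ?leqnSn //.
  by rewrite !mul0mx !addr0 rowE.
rewrite -map_row -rowA -cv_bar; congr (cv _ _).
rewrite /mpoly_bar rmorphM /= map_mpolyX -/(mpoly_bar _) mpoly_bar_real //.
exact: hQreal.
Qed.

Lemma A_adj k j : le_kappa V k.+1 -> (A k j)^t* = (A k j)^T.
Proof. by move=> kk; rewrite -map_trmx A_real. Qed.

(** The functional L: the coordinate on Q_0 = 1. *)
Definition moment p : C := cv 0 p 0 i0.

Lemma moment_sum (I : Type) (s : seq I) (F : I -> {mpoly C[d]}) :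
  moment (\sum_(i <- s) F i) = \sum_(i <- s) moment (F i).
Proof. by rewrite /moment linear_sum summxE. Qed.

Lemma momentZ c p : moment (c *: p) = c * moment p.
Proof. by rewrite /moment linearZ mxE. Qed.

Lemma momentD p q : moment (p + q) = moment p + moment q.
Proof. by rewrite /moment linearD mxE. Qed.

Lemma moment_mod p q : p - q \in V -> moment p = moment q.
Proof.
by move=> /(cvV 0) /eqP; rewrite linearB subr_eq0 /moment => /eqP->.
Qed.

(** Pairing p with the entries of Q_l under L yields its coordinates on Q_l. *)
Definition reproduced (p : {mpoly C[d]}) (l : nat) :=
  forall i, moment (p * Q l i 0) = cv l p 0 i.

Lemma moment_mxpoly_mul p l m (M : 'M[C]_(m, dV V l)) i : reproduced p l ->
  moment (p * mxpoly_mul M (Q l) i 0) = (M *m (cv l p)^T) i 0.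
Proof.
move=> pl; rewrite mxpoly_mulE mulr_sumr moment_sum mxE.
by apply: eq_bigr => i' _; rewrite -scalerAr momentZ pl !mxE.
Qed.

Lemma moment_AQnext p l j i : (le_kappa V l.+1 -> reproduced p l.+1) ->
  cv l.+1 p = 0 -> moment (p * AQnext (A l j) (Q l.+1) i 0) = 0.
Proof.
move=> pl p0; rewrite /AQnext; case: ifP => ll.
  by rewrite moment_mxpoly_mul; [rewrite p0 trmx0 mulmx0 mxE | exact: pl].
by rewrite mxpoly_mul0 mxE mulr0 /moment linear0 mxE.
Qed.

Lemma reproduced_monomial (m : 'X_{1.. d}) l :
  le_kappa V l -> (mdeg m <= l)%N -> reproduced 'X_[m] l.
Proof.
have [n mn] := ubnP (mdeg m); elim: n m mn l => // n IHn m mn l ll ml i.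
case E: (mdeg m) ml => [|e] ml.
  move/eqP: E; rewrite mdeg_eq0 => /eqP->; rewrite mpolyX0 mul1r.
  rewrite -(Q0E i0) /moment; clear ml; case: l ll i => [|l] ll i.
    by rewrite !cvQ // !mxE eq_sym.
  by rewrite !cvQ_neq ?kappa_ge0 // !mxE.
case: l ll ml i => // l ll el i; have ll' := le_kappa_leq (leqnSn l) ll.
have [j [m' [m'e ->]]] := mnm_split C E.
have m'n : (mdeg m' < n)%N by rewrite m'e -ltnS -E.
have rep k : le_kappa V k -> (l <= k)%N -> reproduced 'X_[m'] k.
  by move=> kk lk; apply: IHn => //; rewrite m'e (leq_trans _ lk).
have van k : (l < k)%N -> cv k 'X_[m'] = 0.
  by move=> lk; apply: cv_monomial_gt; rewrite m'e (leq_ltn_trans _ lk).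
rewrite cv_mulX // /cv_prev (van l.+1) // (van l.+2) // !mul0mx !addr0.
(* L(X_j p' q_i) = L(p' (X_j q_i)), to which the recurrence applies. *)
rewrite mulrAC mulrC.
have := idealMr 'X_[m'] (three_termE j i ll).
rewrite mulrBr => /moment_mod ->.
rewrite !mulrDr !momentD moment_AQnext; first last.
- exact: van.
- by move=> ll2; apply: rep => //; rewrite ltnW.
rewrite /AQprev !moment_mxpoly_mul; try by apply: rep.
by rewrite van // trmx0 mulmx0 mxE !add0r A_adj // -trmx_mul mxE.
Qed.

Lemma reproduced_degree (p : {mpoly C[d]}) l :
  le_kappa V l -> (msize p <= l.+1)%N -> reproduced p l.
Proof.
move=> ll pl i; rewrite (mpolyE p) mulr_suml moment_sum linear_sum summxE.
rewrite big_seq [RHS]big_seq; apply: eq_bigr => m mp.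
rewrite -scalerAl momentZ linearZ /= mxE reproduced_monomial //.
by rewrite -ltnS (leq_trans (msize_mdeg_lt mp) pl).
Qed.

Lemma B_sym k j : le_kappa V k -> (B k j)^T = B k j.
Proof.
move=> kk.
have sQ i : msize (Q k i 0) = k.+1 by apply: hQ.1.
(* The A- and A^*-parts of X_j Q_k contribute nothing, as L(Q_k Q_(k+1)^T) and
   L(Q_k Q_(k-1)^T) vanish. *)
have BE i i' : moment (Q k i 0 * ('X_j * Q k i' 0)) = B k j i' i.
  have := idealMr (Q k i 0) (three_termE j i' kk).
  rewrite mulrBr => /moment_mod ->.
  rewrite !mulrDr !momentD moment_AQnext; first last.
  - by rewrite cvQ_neq ?neq_ltn ?leqnn.
  - by move=> kk1; apply: reproduced_degree; rewrite ?sQ // leqW.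
  rewrite add0r moment_mxpoly_mul; last first.
    by apply: reproduced_degree; rewrite ?sQ.
  rewrite cvQ // trmx_delta -colE mxE.
  rewrite [X in _ + X](_ : _ = 0) ?addr0 //.
  case: (k) kk i i' sQ => [|l] ll i i' sQ /=.
    by rewrite mxpoly_mul0 mxE mulr0 /moment linear0 mxE.
  have ll' := le_kappa_leq (leqnSn l) ll.
  rewrite mxpoly_mulE mulr_sumr moment_sum big1 // => u _.
  (* The factor from Q_l plays the role of the polynomial of lower degree. *)
  rewrite -scalerAr momentZ mulrC [Q _ _ _ * _]mulrC reproduced_degree //.
    by rewrite cvQ_neq ?neq_ltn ?leqnn // mxE mul0r.
  by rewrite (hQ.1 l u ll') leqW.
apply/matrixP=> i i'; rewrite mxE -BE -[RHS]BE.
by rewrite !(mulrCA _ 'X_j) [Q k i 0 * _]mulrC.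
Qed.

End Recurrence.

(** * Linear spans *)

Section Span.
Local Set Implicit Arguments.
Local Unset Strict Implicit.
Import GRing.Theory.

Variables (K : fieldType) (E : lmodType K) (S : set E).

Lemma lspanD (x y : E) :
  lspan S x -> lspan S y -> lspan S (x + y).
Proof.
move=> [m [a [v [Sv ->]]]] [n [b [w [Sw ->]]]].
exists (m + n)%N, (fun i => match split i with inl i => a i | inr i => b i end),
  (fun i => match split i with inl i => v i | inr i => w i end); split.
  by move=> i; case: split.
rewrite big_split_ord /=; congr (_ + _); apply: eq_bigr => i _.
  by rewrite (unsplitK (inl i)).
by rewrite (unsplitK (inr i)).
Qed.

Lemma lspanN (x : E) : lspan S x -> lspan S (- x).
Proof.
move=> [m [a [v [Sv ->]]]]; exists m, (fun i => - a i), v; split=> //.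
by rewrite -sumrN; apply: eq_bigr => i _; rewrite scaleNr.
Qed.

Lemma lspan0 : lspan S 0.
Proof. by exists 0, (fun=> 0), (fun=> 0); split; [case|rewrite big_ord0]. Qed.

Lemma lspan_mem (x : E) : S x -> lspan S x.
Proof.
move=> Sx; exists 1, (fun=> 1), (fun=> x); split=> //.
by rewrite big_ord1 scale1r.
Qed.

End Span.

(** * Telescoping modulo V_2 *)

Section ChristoffelDarboux.
Local Arguments dV : simpl never.
Local Set Implicit Arguments.
Local Unset Strict Implicit.
Import GRing.Theory Num.Theory.

Variables (C : numClosedFieldType) (d : nat).
Variable V : idealr {mpoly C[d]}.

Lemma V2_0 : V2 V 0.
Proof.
exists 0; first exact: lspan0.
by exists 0; [exact: lspan0 | rewrite addr0].
Qed.

Lemma V2D p q : V2 V p -> V2 V q -> V2 V (p + q).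
Proof.
move=> [p1 hp1 [p2 hp2 <-]] [q1 hq1 [q2 hq2 <-]].
exists (p1 + q1); first exact: lspanD.
by exists (p2 + q2); [exact: lspanD | rewrite addrACA].
Qed.

Lemma V2N p : V2 V p -> V2 V (- p).
Proof.
move=> [p1 hp1 [p2 hp2 <-]].
exists (- p1); first exact: lspanN.
by exists (- p2); [exact: lspanN | rewrite opprD].
Qed.

Lemma V2_sum (I : Type) (s : seq I) (F : I -> {mpoly C[d + d]}) :
  (forall i, V2 V (F i)) -> V2 V (\sum_(i <- s) F i).
Proof.
move=> hF; elim/big_ind: _ => //; [exact: V2_0 | exact: V2D].
Qed.

Lemma V2_xy (v q : {mpoly C[d]}) : v \in V -> V2 V (in_x v * in_y q).
Proof.
move=> hv; exists (in_x v * in_y q); first by apply: lspan_mem; exists (v, q).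
by exists 0; [exact: lspan0 | rewrite addr0].
Qed.

Lemma V2_yx (v q : {mpoly C[d]}) : v \in V -> V2 V (in_x q * in_y v).
Proof.
move=> hv; exists 0; first exact: lspan0.
exists (in_x q * in_y v); last by rewrite add0r.
by apply: lspan_mem; exists (q, v).
Qed.

Lemma in_xX (j : 'I_d) : in_x 'X_j = Xx C j.
Proof. by rewrite /in_x comp_mpolyXU -tnth_nth tnth_mktuple. Qed.

Lemma in_yX (j : 'I_d) : in_y 'X_j = Xy C j.
Proof. by rewrite /in_y comp_mpolyXU -tnth_nth tnth_mktuple. Qed.

(** The antisymmetrization u(x)^T q(y) - q(x)^T u(y).  For u = X_j q it is
    (x_j - y_j) q(y)^T q(x), and for q = Q_n, u = A_n Q_(n+1) it is the right-hand
    side of the Christoffel-Darboux formula. *)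
Definition skew m (q u : 'cV[{mpoly C[d]}]_m) : {mpoly C[d + d]} :=
  \sum_i (in_x (u i 0) * in_y (q i 0) - in_x (q i 0) * in_y (u i 0)).

Lemma skewD m (q u v : 'cV[{mpoly C[d]}]_m) :
  skew q (u + v) = skew q u + skew q v.
Proof.
rewrite -big_split; apply: eq_bigr => i _ /=.
by rewrite mxE /in_x /in_y !rmorphD /= mulrDl mulrDr opprD addrACA.
Qed.

Lemma skewN m (q u : 'cV[{mpoly C[d]}]_m) : skew q (- u) = - skew q u.
Proof.
rewrite -sumrN; apply: eq_bigr => i _ /=.
by rewrite mxE /in_x /in_y !rmorphN /= mulNr mulrN opprB opprK addrC.
Qed.

Lemma skew0 m (q : 'cV[{mpoly C[d]}]_m) : skew q 0 = 0.
Proof.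
rewrite /skew big1 // => i _.
by rewrite mxE /in_x /in_y !rmorph0 mul0r mulr0 subr0.
Qed.

Lemma skew_ideal m (q u : 'cV[{mpoly C[d]}]_m) :
  (forall i, u i 0 \in V) -> V2 V (skew q u).
Proof.
by move=> uV; apply: V2_sum => i; apply: V2D; [apply: V2_xy|apply/V2N/V2_yx].
Qed.

Lemma skew_trmx m n (M : 'M[C]_(m, n)) (q : 'cV[{mpoly C[d]}]_m)
  (u : 'cV[{mpoly C[d]}]_n) :
  skew u (mxpoly_mul M^T q) = - skew q (mxpoly_mul M u).
Proof.
rewrite /skew -sumrN.
transitivity (\sum_i \sum_i' M i' i *:
    (in_x (q i' 0) * in_y (u i 0) - in_x (u i 0) * in_y (q i' 0))).
  apply: eq_bigr => i _.
  rewrite mxpoly_mulE /in_x /in_y !raddf_sum /= mulr_suml mulr_sumr -sumrB.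
  apply: eq_bigr => i' _.
  by rewrite mxE !linearZ /= -scalerAl -scalerAr scalerBr.
rewrite exchange_big; apply: eq_bigr => i' _ /=.
rewrite mxpoly_mulE /in_x /in_y !raddf_sum /= mulr_suml mulr_sumr -sumrB -sumrN.
apply: eq_bigr => i _.
by rewrite !linearZ /= -scalerAl -scalerAr -scalerBr -scalerN opprB.
Qed.

Lemma skew_symmx m (M : 'M[C]_m) (q : 'cV[{mpoly C[d]}]_m) :
  M^T = M -> skew q (mxpoly_mul M q) = 0.
Proof.
move=> Msym; rewrite /skew.
under eq_bigr => i _ do
  rewrite mxpoly_mulE /in_x /in_y !raddf_sum /= mulr_suml mulr_sumr.
rewrite sumrB; apply/eqP; rewrite subr_eq0; apply/eqP.
rewrite exchange_big; apply: eq_bigr => i _; apply: eq_bigr => i' _ /=.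
by rewrite !linearZ /= -scalerAl -scalerAr -[M in LHS]Msym mxE.
Qed.

Lemma CDrhsE (Q : forall k, 'cV[{mpoly C[d]}]_(dV V k))
    (A : forall k, 'I_d -> 'M[C]_(dV V k, dV V k.+1)) n j :
  CDrhs Q A n j = skew (Q n) (AQnext (A n j) (Q n.+1)).
Proof.
rewrite /CDrhs /skew !mxE -sumrB; apply: eq_bigr => i _.
by rewrite !mxE.
Qed.

Lemma mulX_kernel_term m (q : 'cV[{mpoly C[d]}]_m) (j : 'I_d) : real_col q ->
  (Xx C j - Xy C j) *
    (map_mx (@in_y C d) (col_adj q) *m map_mx (@in_x C d) q) 0 0
  = skew q ('X_j *: q).
Proof.
move=> qr; rewrite mxE mulr_sumr; apply: eq_bigr => i _.
have xM p r : in_x (p * r) = in_x p * in_x r :> {mpoly C[d + d]}.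
  by rewrite /in_x rmorphM.
have yM p r : in_y (p * r) = in_y p * in_y r :> {mpoly C[d + d]}.
  by rewrite /in_y rmorphM.
rewrite !mxE mpoly_bar_real // xM yM in_xX in_yX mulrBl.
by congr (_ - _); [rewrite mulrCA mulrC | rewrite [in_y _ * _]mulrC mulrCA].
Qed.

Lemma christoffel_darboux (Q : forall k, 'cV[{mpoly C[d]}]_(dV V k))
    (A : forall k, 'I_d -> 'M[C]_(dV V k, dV V k.+1))
    (B : forall k, 'I_d -> 'M[C]_(dV V k)) (n : nat) (j : 'I_d) :
    star_ideal V -> rigid_basis Q ->
    (forall k, le_kappa V k -> real_col (Q k)) ->
    Q 0 = const_mx 1 -> three_term Q A B -> le_kappa V n ->
  V2 V ((Xx _ j - Xy _ j) * CDkernel Q n - CDrhs Q A n j).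
Proof.
move=> hV hQ hQreal hQ0 hAB.
have [cv hcv] : exists cv : forall l, {linear {mpoly C[d]} -> 'rV[C]_(dV V l)},
    forall l, coordinate_row Q (cv l).
  exists (fun l => projT1 (cid (exists_coordinate_row hQ l))) => l.
  exact: projT2 (cid (exists_coordinate_row hQ l)).
have hA := A_adj hQ hAB hcv hV hQreal.
have hB := B_sym hQ hQ0 hAB hcv hV hQreal.
move=> nn.
pose T k := (Xx _ j - Xy _ j) *
  (map_mx (@in_y _ _) (col_adj (Q k)) *m map_mx (@in_x _ _) (Q k)) 0 0.
pose S k := skew (Q k) (AQnext (A k j) (Q k.+1)).
(* As A is real, [skew_trmx] turns the last skew term into - S (k - 1); it is
   zero for k = 0. *)
have step k : le_kappa V k ->
    V2 V (T k - S k - skew (Q k) (AQprev (A^~ j) Q k)).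
  move=> kk; rewrite /T mulX_kernel_term; last exact: hQreal.
  (* The zero added to S k is the contribution of the B-part. *)
  rewrite -(addr0 (S k)) -(skew_symmx (Q k) (hB k j kk)) /S -skewD.
  rewrite -!skewN -!skewD -addrA -opprD -addrA.
  apply: skew_ideal => i; have := hAB k j kk i.
  by rewrite addrA !mxE.
elim: n nn => [|n IHn] nn.
- have := step 0 nn; rewrite /AQprev mxpoly_mul0 skew0 subr0.
  by rewrite CDrhsE /CDkernel big_ord1.
have nn' := le_kappa_leq (leqnSn n) nn.
have := V2D (IHn nn') (step _ nn).
rewrite !CDrhsE /AQprev hA // skew_trmx /CDkernel.
rewrite [in X in _ -> X]big_ord_recr /= mulrDr opprK.
have -> : AQnext (A n j) (Q n.+1) = mxpoly_mul (A n j) (Q n.+1).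
  by rewrite /AQnext nn.
by rewrite [_ + skew _ _]addrC addrA subrK addrA.
Qed.

End ChristoffelDarboux.

Theorem theorem5 (R : realType) (d : nat) (hd : (1 <= d)%N)
  (V : idealr {mpoly R[i][d]}) (hV : star_ideal V)
  (Q : forall k : nat, 'cV[{mpoly R[i][d]}]_(dV V k))
  (hQ : rigid_basis Q)
  (hQreal : forall k : nat, le_kappa V k -> real_col (Q k))
  (hQ0 : Q 0%N = const_mx 1)
  (A : forall k : nat, 'I_d -> 'M[R[i]]_(dV V k, dV V k.+1))
  (B : forall k : nat, 'I_d -> 'M[R[i]]_(dV V k))
  (hAB : three_term Q A B) :
  forall (n : nat) (j : 'I_d), le_kappa V n ->
    V2 V ((Xx _ j - Xy _ j) * CDkernel Q n - CDrhs Q A n j).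
Proof. by move=> n j; exact: (christoffel_darboux j hV hQ hQreal hQ0 hAB). Qed.
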